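(* For every integer $\lambda\geq 3$ and every constant $\beta\in(0,1]$ there is a constant $\theta=\theta(\lambda,\beta)>0$ such that the following holds. Let $S\subseteq\{0,1\}^n$ be a cube-ideal set-system with connectivity $\lambda$, and let $F$ be the minimal face of $\mathrm{conv}(S)$ containing some point $x\in\mathbb{R}^n$ with $x_i\in\{\tfrac1\lambda,1-\tfrac1\lambda\}$ for each $i\in[n]$. If $F$ has dimension at least $\beta n$, then $|S\cap F|\geq e^{\theta n}$.
   Context: A set-system is a subset $S\subseteq\{0,1\}^n$; $\mathrm{conv}(S)$ denotes its convex hull. A capacity inequality is one of $x_i\geq 0$ or $x_i\leq 1$. A generalized set covering (GSC) inequality is an inequality $\sum_{i\in I}x_i+\sum_{j\in J}(1-x_j)\geq 1$ for disjoint $I,J\subseteq[n]$; it uses $|I|+|J|$ variables. $S$ is cube-ideal if $\mathrm{conv}(S)$ equals the set of points of $\mathbb{R}^n$ satisfying some finite family of capacity and GSC inequalities. The connectivity of $S$ is the minimum number of variables used in a GSC inequality valid for $\mathrm{conv}(S)$ ($+\infty$ if $S=\{0,1\}^n$). *)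

(* Defs.v *)
From HB Require Import structures.
From mathcomp Require Import all_boot all_order all_algebra.
From mathcomp Require Import all_classical all_reals all_analysis.

Set Implicit Arguments.
Unset Strict Implicit.
Unset Printing Implicit Defensive.

Import Order.TTheory GRing.Theory Num.Theory.

Local Open Scope classical_set_scope.
Local Open Scope ring_scope.

(* A set-system is S : {set 'rV[bool]_n}; 0/1 vectors are embedded in R^n. *)
Definition cube_point (R : realType) (n : nat) (s : 'rV[bool]_n) : 'rV[R]_n :=
  \row_i (s 0 i)%:R.

Definition conv_hull (R : realType) (n : nat) (S : {set 'rV[bool]_n}) :
    set 'rV[R]_n :=
  [set x | exists w : 'rV[bool]_n -> R,
    [/\ forall s, s \in S -> 0 <= w s,
        \sum_(s in S) w s = 1 &
        x = \sum_(s in S) w s *: cube_point R s]].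
Arguments conv_hull R {n} S.

Definition gsc_holds (R : realType) (n : nat) (I J : {set 'I_n})
    (x : 'rV[R]_n) : Prop :=
  1 <= \sum_(i in I) x 0 i + \sum_(j in J) (1 - x 0 j).

Inductive cube_ineq (n : nat) : Type :=
  | CapLower of 'I_n
  | CapUpper of 'I_n
  | Gsc (I J : {set 'I_n}) of [disjoint I & J]%B.

Definition cube_ineq_holds (R : realType) (n : nat) (e : cube_ineq n)
    (x : 'rV[R]_n) : Prop :=
  match e with
  | CapLower i => 0 <= x 0 i
  | CapUpper i => x 0 i <= 1
  | Gsc I0 J0 _ => gsc_holds I0 J0 x
  end.

Definition cube_ideal (R : realType) (n : nat) (S : {set 'rV[bool]_n}) : Prop :=
  exists (m : nat) (e : 'I_m -> cube_ineq n),
    conv_hull R S = [set x | forall k, cube_ineq_holds (e k) x].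

Definition gsc_valid (R : realType) (n : nat) (S : {set 'rV[bool]_n})
    (I J : {set 'I_n}) : Prop :=
  forall x : 'rV[R]_n, conv_hull R S x -> gsc_holds I J x.

(* The minimum over the empty family is +oo. *)
Definition connectivity (R : realType) (n : nat) (S : {set 'rV[bool]_n}) :
    \bar R :=
  \big[Order.min/+oo%E]_(IJ : {set 'I_n} * {set 'I_n} |
      [disjoint IJ.1 & IJ.2]%B && `[< gsc_valid R S IJ.1 IJ.2 >])
    ((#|IJ.1| + #|IJ.2|)%N%:R)%:E.

(* Faces are cut out by valid inequalities <c, y> >= d; P itself (c = 0, d = 0)
   and the empty set (c = 0, d = -1) are faces. *)
Definition is_face (R : realType) (n : nat) (P F : set 'rV[R]_n) : Prop :=
  exists (c : 'rV[R]_n) (d : R),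
    (forall y, P y -> d <= \sum_i c 0 i * y 0 i) /\
    F = [set y | P y /\ \sum_i c 0 i * y 0 i = d].

Definition is_minimal_face_containing (R : realType) (n : nat)
    (P : set 'rV[R]_n) (x : 'rV[R]_n) (F : set 'rV[R]_n) : Prop :=
  [/\ is_face P F, F x &
      forall G, is_face P G -> G x -> G `<=` F -> G = F].

Definition affinely_independent (R : realType) (n k : nat)
    (p : 'I_k -> 'rV[R]_n) : Prop :=
  forall c : 'I_k -> R,
    \sum_i c i = 0 -> \sum_i c i *: p i = 0 -> forall i, c i = 0.

(* The largest k such that A contains k + 1 affinely independent points; in R^n
   this forces k <= n. By convention the value is 0 (not -1) on the empty set. *)
Definition affine_dim (R : realType) (n : nat) (A : set 'rV[R]_n) : nat :=
  \max_(k < n.+1 | `[< exists p : 'I_k.+1 -> 'rV[R]_n,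
      (forall i, A (p i)) /\ affinely_independent p >]) k.

(* Main.v *)
Require Import Defs.
From HB Require Import structures.
From mathcomp Require Import all_boot all_order all_algebra.
From mathcomp Require Import all_classical all_reals all_analysis.
From mathcomp Require Import zify ring lra.

Set Implicit Arguments.
Unset Strict Implicit.
Unset Printing Implicit Defensive.

Import Order.TTheory GRing.Theory Num.Theory.

Local Open Scope classical_set_scope.
Local Open Scope ring_scope.

(* Every valid GSC inequality is either tight at x or has slack at x proportional to
   its number of variables. Hence F contains x + l for every direction l of F whose
   coordinates are at most 1 / (lambda (lambda + 1)) in absolute value, i.e. a section
   of a small cube of dimension at least beta n.

   A 0/1-polytope with few vertices cannot contain such a section. For a large constant
   K, move each grid point w of {0, .., K-1}^n along the direction space of F to a
   point z of [0, K]^n with at most n - dim F coordinates outside {0, K}. Then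
   y = x + (w - z) / (K lambda (lambda + 1)) lies in F, so y is within O(sqrt (n / r))
   of the mean of r vertices of F (Maurey). Grid points sharing the r vertices and the
   half-integer rounding of z differ in few coordinates, so K^n is at most
   C^n K^((1 - beta / 2) n) |S cap F|^r, and K can be chosen so that the claim
   follows. *)

(** * Counting functions by fibers and by exceptional coordinates *)

Lemma card_le_fibers (T U : finType) (f : T -> U) (D : {set U}) (b : nat) :
  (forall x, f x \in D) ->
  (forall u, (#|[set x | f x == u]%SET| <= b)%N) -> (#|T| <= #|D| * b)%N.
Proof.
move=> fD fb; rewrite -[#|T|]sum1_card.
rewrite (partition_big f (fun u => u \in D)) => [|x _]; last exact: fD.
rewrite -sum_nat_const; apply: leq_sum => u _.
by rewrite sum1dep_card; apply: leq_trans (fb u).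
Qed.

(* Weighting every f by the product of #|T| over the coordinates with f i \in E i
   turns the count into a product over the coordinates. *)
Lemma card_mostly_in (n : nat) (T : finType) (E : 'I_n -> {set T}) (e k : nat) :
  (0 < #|T|)%N -> (forall i, (#|E i| <= e)%N) -> (k <= n)%N ->
  (#|[set f : {ffun 'I_n -> T} | (#|[set i | f i \notin E i]%SET| <= k)%N]%SET|
     <= e.+1 ^ n * #|T| ^ k)%N.
Proof.
move=> T0 Ee kn; set M := #|T| in T0 *.
rewrite -(leq_pmul2r (_ : 0 < M ^ (n - k))%N) ?expn_gt0 ?T0 //.
rewrite -mulnA -expnD subnKC // -expnMn.
pose g i (a : T) := if a \in E i then M else 1%N.
apply: (@leq_trans (\sum_(f : {ffun 'I_n -> T}) \prod_i g i (f i))); last first.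
  rewrite -(bigA_distr_bigA g).
  rewrite -[X in (_ <= _ ^ X)%N]card_ord -prod_nat_const; apply: leq_prod => i _.
  rewrite /g (bigID (mem (E i))) /=.
  under eq_bigr => a -> do [].
  rewrite sum_nat_const (eq_bigr (fun=> 1%N)); last by move=> a /negbTE ->.
  rewrite sum1_card mulSn addnC leq_add ?leq_mul //.
  by rewrite /M; apply: max_card.
rewrite -sum_nat_const; set A := finset _.
rewrite [leqRHS](bigID (mem A)) /=; apply: leq_trans (leq_addr _ _).
apply: leq_sum => f; rewrite inE => fk.
rewrite /g -big_mkcond /= prod_nat_const leq_pexp2l //.
rewrite leq_subLR (leq_trans _ (leq_add fk (leqnn _))) //.
rewrite -[leqLHS](card_ord n) -(cardC [set i | f i \notin E i]%SET) leq_add2l.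
by apply: subset_leq_card; apply/fintype.subsetP => i; rewrite !inE negbK.
Qed.

(** * Moving a point of a box to its boundary along a subspace *)

Section Rounding.
Variables (R : realFieldType) (d n : nat) (B : 'M[R]_(d, n)) (N : R).
Hypothesis fB : row_free B.

Let interior (w : 'rV[R]_n) :=
  [set i | (w 0 i != 0) && (w 0 i != N)]%SET.
Let in_box (w : 'rV[R]_n) := forall i, 0 <= w 0 i <= N.

(** Fewer than [d] columns lie outside [T], so the [d] rows of [B] become dependent when restricted
    to them; freeness of [B] keeps the resulting combination nonzero. *)
Lemma sub_row_free_support (T : {set 'I_n}) : (n < #|T| + d)%N ->
  exists l : 'rV[R]_n,
    [/\ (l <= B)%MS, l != 0 & forall i, i \notin T -> l 0 i = 0].
Proof.
move=> Td; pose C := colsub (enum_val : 'I_#|~: T| -> 'I_n) B.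
have : kermx C != 0.
  rewrite kermx_eq0 /row_free; apply/negP => /eqP rC.
  have := rank_leq_col C; rewrite rC cardsCs finset.setCK card_ord.
  have Tn : (#|T| <= n)%N by rewrite -[leqRHS]card_ord max_card.
  by rewrite leqNgt ltn_subLR // Td.
case/rowV0Pn => a /sub_kermxP aC a0; exists (a *m B); split.
- exact: submxMl.
- by rewrite mulmx_free_eq0.
- move=> i iT; have iT' : i \in ~: T by rewrite inE.
  have /rowP/(_ (enum_rank_in iT' i)) := aC.
  rewrite !mxE => aCi; rewrite -[RHS]aCi; apply: eq_bigr => j _.
  by rewrite !mxE enum_rankK_in.
Qed.

Lemma exit_box (w l : 'rV[R]_n) : in_box w -> l != 0 ->
  (forall i, i \notin interior w -> l 0 i = 0) ->
  exists t : R, in_box (w + t *: l) /\ interior (w + t *: l) \proper interior w.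
Proof.
move=> wb l0 lT.
have [i0 li0] : exists i, l 0 i != 0.
  by move: l0; case/rV0Pn => i li; exists i.
(* [tau i] is the time at which coordinate [i] hits the wall it moves towards. At the smallest such
   time no coordinate has left the box and the minimiser sits on a wall. *)
pose tau i := if 0 < l 0 i then (N - w 0 i) / l 0 i else - w 0 i / l 0 i.
case: (@arg_minP _ _ _ i0 (fun i => l 0 i != 0) tau li0) => i li imin.
have tau0 j : l 0 j != 0 -> 0 <= tau j.
  move=> lj; have /andP[w0 wN] := wb j; rewrite /tau.
  case: ltrP => lj0; first by rewrite divr_ge0 ?subr_ge0 // ltW.
  by rewrite mulNr oppr_ge0 mulr_ge0_le0 ?invr_le0.
exists (tau i); split.
  move=> j; rewrite !mxE; have /andP[w0 wN] := wb j.
  have [->|lj] := eqVneq (l 0 j) 0; first by rewrite mulr0 addr0 w0.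
  have := imin j lj; have t0 := tau0 i li; rewrite {2}/tau.
  case: ltrP => lj0.
    rewrite ler_pdivlMr // => h; apply/andP; split; last lra.
    by rewrite addr_ge0 ?mulr_ge0 // ltW.
  have lj1 : l 0 j < 0 by rewrite lt_neqAle lj lj0.
  rewrite ler_ndivlMr // => h; apply/andP; split; first lra.
  have : tau i * l 0 j <= 0 by rewrite mulr_ge0_le0.
  lra.
apply/properP; split.
  apply/fintype.subsetP => j; apply: contraTT => jT.
  by move: (jT); rewrite !inE !mxE lT // mulr0 addr0.
exists i; first by apply: contraNT li => /lT ->.
rewrite !inE !mxE /tau; case: ifP => _; rewrite divfK //.
  by rewrite addrCA subrr addr0 eqxx andbF.
by rewrite subrr eqxx.
Qed.

(** While more than [n - d] coordinates are interior, some direction in the row space of [B] moves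
    only interior ones; following it to the first wall lowers their number. *)
Lemma round_to_boundary (w : 'rV[R]_n) : in_box w ->
  exists w', [/\ in_box w', (w' - w <= B)%MS &
    (#|interior w'| + d <= n)%N].
Proof.
have [m] := ubnP #|interior w|; elim: m w => // m IH w wm wb.
have [le|gt] := leqP (#|interior w| + d) n.
  by exists w; split => //; rewrite subrr sub0mx.
have [l [lB l0 lT]] := sub_row_free_support gt.
have [t [tb /proper_card tT]] := exit_box wb l0 lT.
have [|w' [w'b w'B w'T]] := IH _ _ tb; first exact: leq_trans tT _.
exists w'; split => //.
have -> : w' - w = (w' - (w + t *: l)) + t *: l by rewrite opprD addrA subrK.
by rewrite addmx_sub // scalemx_sub.
Qed.

End Rounding.

(** * Approximation of a point by the mean of few vertices *)

(* Maurey's empirical approximation, derandomised: the next point is chosen so that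
   it does not correlate positively with the accumulated error. *)
Lemma empirical_approx (R : realType) (n : nat) (V : {set 'rV[bool]_n})
    (y : 'rV[R]_n) :
  (forall i, 0 <= y 0 i <= 1) ->
  (forall u : 'rV[R]_n, exists2 s, s \in V &
     \sum_i u 0 i * cube_point R s 0 i <= \sum_i u 0 i * y 0 i) ->
  forall r, exists t : {ffun 'I_r -> 'rV[bool]_n}, (forall j, t j \in V) /\
    \sum_i (\sum_j (cube_point R (t j) 0 i - y 0 i)) ^+ 2 <= r%:R * n%:R.
Proof.
move=> y01 yV r.
suff [s [sr sV sle]] : exists s : seq 'rV[bool]_n, [/\ size s = r,
    {subset s <= V} &
    \sum_i (\sum_(v <- s) (cube_point R v 0 i - y 0 i)) ^+ 2 <= r%:R * n%:R].
  have [s0 _ _] := yV 0.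
  exists [ffun j : 'I_r => nth s0 s j]; split.
    by move=> j; rewrite ffunE sV // mem_nth // sr.
  congr (_ <= _) : sle; apply: eq_bigr => i _.
  rewrite (big_nth s0) sr big_mkord; congr (_ ^+ 2).
  by apply: eq_bigr => j _; rewrite ffunE.
elim: r => [|r [s [sr sV sle]]].
  exists [::]; split => //; rewrite mul0r big1 // => i _.
  by rewrite big_nil expr0n.
pose u := \row_i \sum_(v <- s) (cube_point R v 0 i - y 0 i).
have [v vV vle] := yV u.
exists (v :: s); split; first by rewrite /= sr.
  by move=> z; rewrite inE => /orP[/eqP->//|/sV].
have -> : \sum_i (\sum_(v0 <- v :: s) (cube_point R v0 0 i - y 0 i)) ^+ 2 =
  \sum_i (\sum_(v0 <- s) (cube_point R v0 0 i - y 0 i)) ^+ 2 +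
  2 * (\sum_i u 0 i * cube_point R v 0 i - \sum_i u 0 i * y 0 i) +
  \sum_i (cube_point R v 0 i - y 0 i) ^+ 2.
  rewrite -sumrB mulr_sumr -!big_split /=; apply: eq_bigr => i _.
  rewrite big_cons.
  have <- : u 0 i = \sum_(v0 <- s) (cube_point R v0 0 i - y 0 i) by rewrite mxE.
  ring.
have : \sum_i (cube_point R v 0 i - y 0 i) ^+ 2 <= n%:R.
  rewrite -[n in leRHS]card_ord -sumr_const; apply: ler_sum => i _.
  rewrite mxE; have /andP[y0 y1] := y01 i.
  by case: (v 0 i) => /=; nra.
rewrite -natr1 mulrDl mul1r; lra.
Qed.

(** * Faces of the hull and their directions *)

(** Add the two valid inequalities: on [P], equality in the sum forces equality in both. *)
Lemma face_setI (R : realType) (n : nat) (P F G : set 'rV[R]_n) :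
  is_face P F -> is_face P G -> is_face P (F `&` G).
Proof.
move=> [c [a [ca ->]]] [d [b [db ->]]].
have cdE (y : 'rV[R]_n) : \sum_i (c + d) 0 i * y 0 i =
    \sum_i c 0 i * y 0 i + \sum_i d 0 i * y 0 i.
  by rewrite -big_split /=; apply: eq_bigr => i _; rewrite mxE mulrDl.
exists (c + d), (a + b); split.
  by move=> y Py; rewrite cdE lerD ?ca ?db.
apply/seteqP; split=> y /=; rewrite cdE.
  by move=> [[Py ->] [_ ->]].
move=> [Py e]; have := ca y Py; have := db y Py => h1 h2.
by do !split => //; lra.
Qed.

(** Minimality only speaks of faces inside [F], so it is applied to the intersection of [F] and
    [G]. *)
Lemma minimal_face_sub (R : realType) (n : nat) (P F G : set 'rV[R]_n)
    (x : 'rV[R]_n) :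
  is_minimal_face_containing P x F -> is_face P G -> G x -> F `<=` G.
Proof.
move=> [fF Fx minF] fG Gx.
have FG : F `&` G = F by apply: minF => [|//|y []//]; exact: face_setI.
by rewrite -FG => y [].
Qed.

(** Write [y] as a convex combination. Tightness of the face inequality at [y] puts all weight on
    vertices in [F], and they cannot all have a larger product with [u] than their mean. This is the
    vertex choice that [empirical_approx] requires. *)
Lemma face_supporting_point (R : realType) (n : nat) (S : {set 'rV[bool]_n})
    (F : set 'rV[R]_n) (y u : 'rV[R]_n) :
  is_face (conv_hull R S) F -> F y ->
  exists2 s, s \in [set s in S | cube_point R s \in F]%SET &
    \sum_i u 0 i * cube_point R s 0 i <= \sum_i u 0 i * y 0 i.
Proof.
move=> [c [d [cd FE]]] Fy.
have hullS s : s \in S -> conv_hull R S (cube_point R s).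
  move=> sS; exists (fun s' => (s' == s)%:R); split => //.
    by rewrite (bigD1 s) //= eqxx big1 ?addr0 // => i /andP[_ /negbTE ->].
  by rewrite (bigD1 s) //= eqxx scale1r big1 ?addr0 // => i /andP[_ /negbTE ->];
     rewrite scale0r.
move: (Fy); rewrite {1}FE => -[[w [w0 w1 yE]] cy].
have dotE (a : 'rV[R]_n) : \sum_i a 0 i * y 0 i =
    \sum_(s in S) w s * \sum_i a 0 i * cube_point R s 0 i.
  rewrite yE; under eq_bigr do rewrite summxE mulr_sumr.
  rewrite exchange_big /=; apply: eq_bigr => s _; rewrite mulr_sumr.
  by apply: eq_bigr => i _; rewrite !mxE mulrCA.
have wF s : s \in S -> w s != 0 -> cube_point R s \in F.
  move=> sS ws; rewrite inE FE; split; first exact: hullS.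
  have : \sum_(s in S) w s * (\sum_i c 0 i * cube_point R s 0 i - d) = 0.
    under eq_bigr do rewrite mulrBr.
    by rewrite sumrB -dotE cy -mulr_suml w1 mul1r subrr.
  move/eqP; rewrite psumr_eq0; last first.
    by move=> t tS; rewrite mulr_ge0 ?w0 // subr_ge0 cd //; exact: hullS.
  move/allP/(_ s); rewrite mem_index_enum sS /= mulf_eq0 (negbTE ws) subr_eq0.
  by move/(_ isT)/eqP.
apply: contrapT => nex.
have gt s : s \in S -> w s != 0 ->
    0 < \sum_i u 0 i * cube_point R s 0 i - \sum_i u 0 i * y 0 i.
  move=> sS ws; rewrite subr_gt0 ltNge; apply/negP => le; apply: nex.
  by exists s => //; rewrite finset.in_set sS wF.
have : \sum_(s in S) w s *
    (\sum_i u 0 i * cube_point R s 0 i - \sum_i u 0 i * y 0 i) = 0.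
  under eq_bigr do rewrite mulrBr.
  by rewrite sumrB -dotE -mulr_suml w1 mul1r subrr.
move/eqP; rewrite psumr_eq0; last first.
  move=> s sS; have [->|ws] := eqVneq (w s) 0; first by rewrite mul0r.
  by rewrite mulr_ge0 ?w0 // ltW ?gt.
move/allP => w_eq0; have := oner_neq0 R; rewrite -w1 big1 ?eqxx // => s sS.
have := w_eq0 s; rewrite mem_index_enum sS mulf_eq0 => /(_ isT) /=.
case: eqVneq => //= ws /eqP e; have := gt s sS ws.
by rewrite e ltxx.
Qed.

Lemma conv_hull_box (R : realType) (n : nat) (S : {set 'rV[bool]_n})
    (y : 'rV[R]_n) i :
  conv_hull R S y -> 0 <= y 0 i <= 1.
Proof.
move=> [w [w0 w1 ->]]; rewrite summxE -w1.
apply/andP; split; [apply: sumr_ge0 | apply: ler_sum] => s /w0 ws;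
  rewrite !mxE; case: (s 0 i); rewrite ?mulr1 ?mulr0 //.
Qed.

Lemma direction_matrix (R : realType) (n : nat) (A : set 'rV[R]_n)
    (x : 'rV[R]_n) : A x ->
  exists B : 'M[R]_(affine_dim A, n), row_free B /\
    forall i, exists p q, [/\ A p, A q & row i B = p - q].
Proof.
move=> Ax; pose D := [pred k : 'I_n.+1 |
  `[< exists p : 'I_k.+1 -> 'rV[R]_n,
        (forall i, A (p i)) /\ affinely_independent p >]].
(* The single point [x] realises [k = 0], so the maximum defining [affine_dim] is attained and not a
   default value. *)
have D0 : (0 < #|D|)%N.
  apply/card_gt0P; exists ord0; apply/asboolP; exists (fun=> x); split => // c.
  by rewrite big_ord1 => c0 _ i; rewrite (ord1 i).
have [k /asboolP[p [pA pind]] kE] := eq_bigmax_cond (fun k : 'I_n.+1 => k : nat) D0.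
have -> : affine_dim A = k by rewrite -kE.
exists (\matrix_i (p (lift ord0 i) - p ord0)); split; last first.
  by move=> i; exists (p (lift ord0 i)), (p ord0); rewrite rowK.
apply/inj_row_free => v vB.
(* The coefficient of the base point makes the sum zero, turning a linear relation between the
   differences into an affine one between the points. *)
pose c (i : 'I_k.+1) : R := if unlift ord0 i is Some j then v 0 j else - \sum_j v 0 j.
have c0 : c ord0 = - \sum_j v 0 j by rewrite /c unlift_none.
have cS (j : 'I_k) : c (lift ord0 j) = v 0 j by rewrite /c liftK.
apply/rowP => j; rewrite mxE -cS; apply: pind.
  rewrite big_ord_recl c0 [X in _ + X](eq_bigr (v 0)) ?addNr //.
rewrite big_ord_recl c0.
under [X in _ + X]eq_bigr do rewrite cS.
rewrite scaleNr scaler_suml addrC -sumrB -[RHS]vB mulmx_sum_row.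
by apply: eq_bigr => i _; rewrite rowK scalerBr.
Qed.

(** * Slack of GSC inequalities at [x] and directions of the minimal face *)

(** The witness [b] counts the terms that differ from [u]. *)
Lemma sum_two_values (R : pzRingType) (T : finType) (A : {set T}) (f : T -> R)
    (u v : R) : (forall i, f i = u \/ f i = v) ->
  exists b : nat, \sum_(i in A) f i = #|A|%:R * u + b%:R * (v - u).
Proof.
move=> fuv; exists (\sum_(i in A) (f i != u))%N.
rewrite natr_sum mulr_suml mulr_natl -sumr_const -big_split /=.
apply: eq_bigr => i _; case: eqVneq => [->|/eqP fu]; first by rewrite mul0r addr0.
by case: (fuv i) => // ->; rewrite mul1r addrCA subrr addr0.
Qed.

Section Gsc.
Variables (R : realType) (n lambda : nat) (x : 'rV[R]_n).
Hypothesis lambda_ge3 : (3 <= lambda)%N.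
Hypothesis x_val : forall i, x 0 i = lambda%:R^-1 \/ x 0 i = 1 - lambda%:R^-1.

(** The slack per variable in the extremal case: [lambda + 1] terms equal to [1 / lambda] exceed 1
    by [1 / lambda]. *)
Let rho : R := (lambda * lambda.+1)%:R^-1.

Definition gsc_value (I J : {set 'I_n}) (y : 'rV[R]_n) : R :=
  \sum_(i in I) y 0 i + \sum_(j in J) (1 - y 0 j).

Definition gsc_lin (I J : {set 'I_n}) (l : 'rV[R]_n) : R :=
  \sum_(i in I) l 0 i - \sum_(j in J) l 0 j.

Definition gsc_row (I J : {set 'I_n}) : 'rV[R]_n :=
  \row_i ((i \in I)%:R - (i \in J)%:R).

Lemma gsc_valueD (I J : {set 'I_n}) y l :
  gsc_value I J (y + l) = gsc_value I J y + gsc_lin I J l.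
Proof.
rewrite /gsc_value /gsc_lin.
under eq_bigr do rewrite mxE.
under [\sum_(j in J) (1 - (y + l) 0 j)]eq_bigr do rewrite mxE opprD addrA.
rewrite big_split sumrB /=; lra.
Qed.

Lemma gsc_rowE (I J : {set 'I_n}) (l : 'rV[R]_n) :
  \sum_i gsc_row I J 0 i * l 0 i = gsc_lin I J l.
Proof.
rewrite /gsc_lin [\sum_(i in I) _]big_mkcond [\sum_(i in J) _]big_mkcond -sumrB.
by apply: eq_bigr => i _; rewrite mxE mulrBl; do 2![case: ifP => _];
  rewrite ?mul1r ?mul0r.
Qed.

(** With [k] variables and [u = 1 / lambda], the value at [x] is [k * u + c * (1 - 2 * u)] for a
    natural number [c]. If [c = 0] it is 1 at [k = lambda], and for [k > lambda] the choice of [rho]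
    suffices. If [c > 0] the bound follows from [lambda ^ 2 >= 2 * lambda + 2], which is where
    [lambda >= 3] enters. *)
Lemma gsc_slack (I J : {set 'I_n}) : (lambda <= #|I| + #|J|)%N ->
  gsc_value I J x = 1 \/
  1 + (#|I| + #|J|)%:R * rho <= gsc_value I J x.
Proof.
move=> le; set L : R := lambda%:R; set u := L^-1.
have L3 : 3 <= L by rewrite ler_nat.
have Lu : L * u = 1 by rewrite divff // gt_eqF //; lra.
have rho0 : 0 < rho by rewrite invr_gt0 ltr0n muln_gt0 (leq_trans _ lambda_ge3).
have rhoE : L * (L + 1) * rho = 1.
  rewrite /rho natrM -natr1 -/L divff // gt_eqF //.
  by rewrite mulr_gt0 //; lra.
have uE : u = (L + 1) * rho.
  by rewrite -[LHS]mulr1 -[X in _ * X = _]rhoE 2!mulrA (mulrC u) Lu mul1r.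
have [a aE] := sum_two_values I x_val.
have [b bE] : exists b : nat, \sum_(j in J) (1 - x 0 j) =
    #|J|%:R * u + b%:R * (1 - u - u).
  by apply: sum_two_values => j; case: (x_val j) => ->; [right | left; rewrite subKr].
have vE : gsc_value I J x = (#|I| + #|J|)%:R * u + (a + b)%:R * (1 - 2 * u).
  rewrite /gsc_value aE bE !natrD -/L -/u; ring.
rewrite vE; move: le; set k := (#|I| + #|J|)%N => le.
have kL : L <= k%:R by rewrite ler_nat.
have u2 : 0 <= 1 - 2 * u by nra.
have key : k%:R * u = k%:R * rho + k%:R * (L * rho) by rewrite uE; ring.
have Lrho : 0 < L * rho by nra.
case: (posnP (a + b)) => [->|ab]; last first.
  right; have : 1 - 2 * u <= (a + b)%:R * (1 - 2 * u).
    by rewrite ler_peMl // (ler_nat _ 1).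
  have : 2 * u <= k%:R * (L * rho).
    rewrite uE; have : L * (L * rho) <= k%:R * (L * rho) by rewrite ler_pM2r.
    nra.
  lra.
rewrite mul0r addr0; case: (ltnP lambda k) => kl; last first.
  by left; have -> : k = lambda by apply/eqP; rewrite eqn_leq kl.
right; have : (L + 1) * (L * rho) <= k%:R * (L * rho).
  by rewrite ler_pM2r // natr1 ler_nat.
lra.
Qed.

Lemma gsc_lin_ge (I J : {set 'I_n}) (l : 'rV[R]_n) : (forall i, `|l 0 i| <= rho) ->
  - ((#|I| + #|J|)%:R * rho) <= gsc_lin I J l.
Proof.
move=> lr; rewrite natrD mulrDl opprD lerD //.
  rewrite -mulrN mulr_natl -sumr_const; apply: ler_sum => i _.
  by have := lr i; rewrite ler_norml => /andP[].
rewrite lerN2 mulr_natl -sumr_const; apply: ler_sum => i _.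
by have := lr i; rewrite ler_norml => /andP[].
Qed.

Variable S : {set 'rV[bool]_n}.
Hypothesis S_ideal : cube_ideal R S.
Hypothesis S_conn : connectivity R S = (lambda%:R)%:E.

(** Directions that keep every valid GSC inequality tight at [x] tight: a linear stand-in for the
    direction space of [F]. *)
Definition flat (l : 'rV[R]_n) : Prop :=
  forall I J : {set 'I_n}, [disjoint I & J]%B -> gsc_valid R S I J ->
    gsc_value I J x = 1 -> gsc_lin I J l = 0.

Lemma gsc_valid_card (I J : {set 'I_n}) :
  [disjoint I & J]%B -> gsc_valid R S I J -> (lambda <= #|I| + #|J|)%N.
Proof.
move=> dIJ vIJ; rewrite -(ler_nat R) -lee_fin -S_conn /connectivity.
by apply: (bigmin_le_cond _ (j := (I, J))); rewrite dIJ; apply/asboolP.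
Qed.

(** Flatness preserves the tight inequalities, and the slack of the others absorbs a change of [rho]
    per variable. Capacity inequalities survive because [rho <= 1 / lambda]. *)
Lemma hull_perturb (l : 'rV[R]_n) : (forall i, `|l 0 i| <= rho) -> flat l ->
  conv_hull R S (x + l).
Proof.
move=> lr fl; have [m [e hE]] := S_ideal; rewrite hE => k /=.
have vk y : conv_hull R S y -> cube_ineq_holds (e k) y by rewrite hE; apply.
have L3 : 3 <= lambda%:R :> R by rewrite ler_nat.
have L0 : 0 < lambda%:R :> R by lra.
have ru : rho <= lambda%:R^-1.
  by rewrite lef_pV2 ?posrE ?ltr0n ?muln_gt0 ?ler_nat ?leq_pmulr //;
     rewrite (leq_trans _ lambda_ge3).
have u3 : lambda%:R^-1 <= 3^-1 :> R by rewrite lef_pV2 ?posrE.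
have x_in i : lambda%:R^-1 <= x 0 i <= 1 - lambda%:R^-1.
  by case: (x_val i) => ->; apply/andP; split; lra.
have l_in i : - rho <= l 0 i <= rho by rewrite -ler_norml.
case: (e k) vk => [i|i|I J dIJ] vk /=.
- rewrite mxE; move: (x_in i) (l_in i) => /andP[? ?] /andP[? ?]; lra.
- rewrite mxE; move: (x_in i) (l_in i) => /andP[? ?] /andP[? ?]; lra.
- rewrite /gsc_holds -/(gsc_value I J _) gsc_valueD.
  have [x1|x1] := gsc_slack (gsc_valid_card dIJ vk).
    by rewrite x1 fl // addr0.
  have := gsc_lin_ge I J lr; lra.
Qed.

(** Both [x + l] and [x - l] lie in the hull and their midpoint [x] is on the supporting hyperplane,
    hence so are they. *)
Lemma face_perturb F (l : 'rV[R]_n) : is_face (conv_hull R S) F -> F x ->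
  (forall i, `|l 0 i| <= rho) -> flat l -> F (x + l).
Proof.
move=> [c [d [cd ->]]] [hx cx] lr fl /=.
have hp := hull_perturb lr fl; split => //.
have hm : conv_hull R S (x - l).
  apply: hull_perturb => [i|I J dIJ vIJ x1]; first by rewrite mxE normrN.
  rewrite /gsc_lin; under eq_bigr do rewrite mxE.
  under [\sum_(j in J) _]eq_bigr do rewrite mxE.
  by rewrite !sumrN -opprD [X in - X](fl I J) ?oppr0.
have split_dot (y : 'rV[R]_n) : \sum_i c 0 i * (x + y) 0 i = d + \sum_i c 0 i * y 0 i.
  by rewrite -cx -big_split; apply: eq_bigr => i _; rewrite mxE mulrDr.
have dotN : \sum_i c 0 i * (- l) 0 i = - \sum_i c 0 i * l 0 i.
  by rewrite -sumrN; apply: eq_bigr => i _; rewrite mxE mulrN.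
have := cd _ hp; have := cd _ hm; rewrite !split_dot dotN; lra.
Qed.

(** A valid GSC inequality tight at [x] cuts out a face through [x], which contains [F]; so it is
    constant on [F]. *)
Lemma minimal_face_flat F (p q : 'rV[R]_n) :
  is_minimal_face_containing (conv_hull R S) x F ->
  F p -> F q -> flat (p - q).
Proof.
move=> minF Fp Fq I J dIJ vIJ x1.
pose G := [set y | conv_hull R S y /\
  \sum_i gsc_row I J 0 i * y 0 i = 1 - gsc_value I J 0].
have linE y : gsc_value I J y = gsc_value I J 0 + gsc_lin I J y.
  by rewrite -gsc_valueD add0r.
have FG : F `<=` G.
  apply: (minimal_face_sub minF).
    exists (gsc_row I J), (1 - gsc_value I J 0); split => // y /vIJ.
    by rewrite gsc_rowE /gsc_holds -/(gsc_value I J y) linE; lra.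
  case: minF => -[c [d [_ ->]]] [hx _] _; split => //.
  by rewrite gsc_rowE; move: x1; rewrite linE; lra.
have [_ Gp] := FG _ Fp; have [_ Gq] := FG _ Fq.
rewrite !gsc_rowE in Gp Gq.
have := gsc_valueD I J q (p - q).
rewrite addrCA subrr addr0 (linE p) (linE q) Gp Gq; lra.
Qed.

Lemma flat_rowspace (d : nat) (B : 'M[R]_(d, n)) (l : 'rV[R]_n) :
  (forall i, flat (row i B)) -> (l <= B)%MS -> flat l.
Proof.
move=> fB /submxP[a ->] I J dIJ vIJ x1.
have linE (y : 'rV[R]_n) : gsc_lin I J y = (y *m (gsc_row I J)^T) 0 0.
  by rewrite -gsc_rowE mxE; apply: eq_bigr => i _; rewrite mulrC [in RHS]mxE.
have BI : B *m (gsc_row I J)^T = 0.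
  apply/row_matrixP => i; rewrite row_mul row0; apply/matrixP => j k.
  by rewrite !ord1 -linE fB // mxE.
by rewrite linE -mulmxA BI mulmx0 mxE.
Qed.

End Gsc.

(** * Encoding grid points and counting the codes *)

(* The error vectors of two points that are approximated by the same r-tuple differ
   by r times the difference of the points. *)
Lemma hamming_from_errors (R : realType) (n K q D r : nat)
    (w1 w2 : {ffun 'I_n -> 'I_K}) (x z1 z2 : 'rV[R]_n)
    (t : {ffun 'I_r -> 'rV[bool]_n}) :
  let y (w : {ffun 'I_n -> 'I_K}) (z : 'rV[R]_n) :=
    x + (K * D)%:R^-1 *: (\row_i (w i)%:R - z) in
  let err (y : 'rV[R]_n) :=
    \sum_i (\sum_j (cube_point R (t j) 0 i - y 0 i)) ^+ 2 in
  (0 < K * D)%N -> (0 < q)%N -> r = (16 * q * (K * D) ^ 2)%N ->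
  (forall i, `|z1 0 i - z2 0 i| <= 2^-1) ->
  err (y w1 z1) <= r%:R * n%:R -> err (y w2 z2) <= r%:R * n%:R ->
  (#|[set i | w1 i != w2 i]%SET| * q <= n)%N.
Proof.
move=> y err KD0 q0 rE z12 e1 e2; set H := finset _.
set s : R := (K * D)%:R^-1.
pose delta i : R := (w1 i)%:R - (w2 i)%:R - (z1 0 i - z2 0 i).
have errB i : (r%:R * s * delta i) ^+ 2 <=
    2 * (\sum_j (cube_point R (t j) 0 i - y w1 z1 0 i)) ^+ 2 +
    2 * (\sum_j (cube_point R (t j) 0 i - y w2 z2 0 i)) ^+ 2.
  rewrite !sumrB !sumr_const !card_ord; set c := \sum_(j < r) _.
  have -> : r%:R * s * delta i = y w1 z1 0 i *+ r - y w2 z2 0 i *+ r.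
    rewrite -(mulr_natl (y w1 z1 0 i)) -(mulr_natl (y w2 z2 0 i)) /delta /y !mxE -/s.
    ring.
  set a := _ *+ r; set b := _ *+ r; have := sqr_ge0 (2 * c - a - b); nra.
have sum_le : \sum_i (r%:R * s * delta i) ^+ 2 <= 4 * (r%:R * n%:R).
  apply: le_trans (ler_sum _ (fun i _ => errB i)) _.
  by rewrite big_split /= -!mulr_sumr -/(err (y w1 z1)) -/(err (y w2 z2)); lra.
(* Distinct integers are at least 1 apart and the [z] parts at most 1/2, so [delta i] is at least
   1/2 in absolute value. *)
have delta_ge i : i \in H -> 4^-1 <= delta i ^+ 2.
  rewrite inE => wi.
  have : 1 <= `|(w1 i)%:R - (w2 i)%:R| :> R.
    move: wi; rewrite -val_eqE /= neq_ltn ler_normr => /orP[] lt; apply/orP.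
      have : (w1 i).+1%:R <= (w2 i)%:R :> R by rewrite ler_nat.
      by rewrite -natr1 => ?; right; lra.
    have : (w2 i).+1%:R <= (w1 i)%:R :> R by rewrite ler_nat.
    by rewrite -natr1 => ?; left; lra.
  have : `|(w1 i)%:R - (w2 i)%:R| <= `|delta i| + `|z1 0 i - z2 0 i|.
    by rewrite -[X in `|X| <= _](subrK (z1 0 i - z2 0 i)) ler_normD.
  have := z12 i; rewrite -[delta i ^+ 2]real_normK ?num_real //.
  have := normr_ge0 (delta i); nra.
have H_le : #|H|%:R * ((r%:R * s) ^+ 2 / 4) <= 4 * (r%:R * n%:R).
  apply: le_trans sum_le; rewrite (bigID (mem H)) /=.
  rewrite -[X in X <= _]addr0 lerD //; last by apply: sumr_ge0 => i _; exact: sqr_ge0.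
  rewrite mulr_natl -sumr_const; apply: ler_sum => i iH.
  by rewrite [leRHS]exprMn ler_wpM2l ?sqr_ge0 ?delta_ge.
(* The factor 16 in [r] is chosen here: after division by [r], [H_le] becomes
   [4 * q * #|H| <= 4 * n]. *)
have rs : r%:R * s ^+ 2 = 16 * q%:R.
  rewrite rE natrM natrX (natrM _ 16 q) /s -mulrA.
  by rewrite -exprMn divff ?expr1n ?mulr1 // pnatr_eq0 -lt0n.
have r0 : 0 < r%:R :> R by rewrite ltr0n rE muln_gt0 expn_gt0 KD0 muln_gt0 q0.
rewrite -(ler_nat R) natrM -(ler_pM2l r0).
move: H_le; have -> : (r%:R * s) ^+ 2 = r%:R * (r%:R * s ^+ 2) by ring.
rewrite rs; nra.
Qed.

(** A grid point is encoded by its boundary point [z], rounded to half-integers, and its [r]-tuple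
    of vertices. The first three factors count roundings and tuples; the last bounds a fiber, which
    lies in a Hamming ball of radius [n %/ q]. *)
Lemma encode_grid (R : realType) (n d K q D r : nat) (B : 'M[R]_(d, n))
    (x : 'rV[R]_n) (V : {set 'rV[bool]_n}) :
  row_free B -> (0 < K * D)%N -> (0 < q)%N -> r = (16 * q * (K * D) ^ 2)%N ->
  (forall l : 'rV[R]_n, (l <= B)%MS -> (forall i, `|l 0 i| <= D%:R^-1) ->
     exists t : {ffun 'I_r -> 'rV[bool]_n}, (forall j, t j \in V) /\
     \sum_i (\sum_j (cube_point R (t j) 0 i - (x + l) 0 i)) ^+ 2 <= r%:R * n%:R) ->
  (K ^ n <= 3 ^ n * (2 * K).+1 ^ (n - d) * #|V| ^ r * (2 ^ n * K ^ (n %/ q)))%N.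
Proof.
move=> fB KD0 q0 rE approx.
have K0 : (0 < K)%N by move: KD0; rewrite muln_gt0 => /andP[].
have D0 : (0 < D)%N by move: KD0; rewrite muln_gt0 => /andP[].
pose W := {ffun 'I_n -> 'I_K}; pose row_of (w : W) : 'rV[R]_n := \row_i (w i)%:R.
pose good (w : W) (zt : 'rV[R]_n * {ffun 'I_r -> 'rV[bool]_n}) :=
  [/\ forall i, 0 <= zt.1 0 i <= K%:R,
      (#|[set i | ((zt.1 0%R i != 0) && (zt.1 0%R i != K%:R))%R]%SET| + d <= n)%N,
      forall j, zt.2 j \in V &
      \sum_i (\sum_j (cube_point R (zt.2 j) 0 i -
        (x + (K * D)%:R^-1 *: (row_of w - zt.1)) 0 i)) ^+ 2 <= r%:R * n%:R].
have w_in w i : 0 <= row_of w 0 i <= K%:R by rewrite mxE ler0n ler_nat ltnW.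
have /choice[f fP] : forall w, exists zt, good w zt.
  move=> w; have [z [zb zB zd]] := round_to_boundary fB (w_in w).
  have [||t [tV tE]] := approx ((K * D)%:R^-1 *: (row_of w - z)).
  - by rewrite scalemx_sub // -opprB eqmx_opp.
  - move=> i; rewrite !mxE normrM normfV normr_nat natrM invfM.
    rewrite mulrAC -[X in _ <= X]mul1r ler_wpM2r ?invr_ge0 ?ler0n //.
    rewrite mulrC ler_pdivrMr ?ltr0n // mul1r.
    move: (zb i) (w_in w i); rewrite mxE => /andP[? ?] /andP[? ?].
    by rewrite ler_norml; apply/andP; split; lra.
  by exists (z, t); split.
(* Doubling before truncation makes equal codes force the [z] coordinates within 1/2. As
   [2 * z <= 2 * K], [inord] never takes its default value. *)
pose code w : {ffun 'I_n -> 'I_(2 * K).+1} :=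
  [ffun i => inord (Num.truncn (2 * (f w).1 0 i))].
have codeE w i : code w i = Num.truncn (2 * (f w).1 0 i) :> nat.
  have [/(_ i)/andP[z0 zK] _ _ _] := fP w; rewrite ffunE inordK // ltnS.
  rewrite -(ler_nat R) natrM.
  have /andP[le _] := @truncn_itv R (2 * (f w).1 0 i) ltac:(lra).
  by apply: le_trans le _; lra.
pose codes := [set c : {ffun 'I_n -> 'I_(2 * K).+1} |
  (#|[set i | c i \notin [set ord0; ord_max]%SET]%SET| <= n - d)%N]%SET.
pose tuples := [set t : {ffun 'I_r -> 'rV[bool]_n} | t \in ffun_on (mem V)]%SET.
have card_codes : (#|codes| <= 3 ^ n * (2 * K).+1 ^ (n - d))%N.
  rewrite -[(2 * K).+1 in leqRHS]card_ord; apply: card_mostly_in.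
  - by rewrite card_ord.
  - by move=> _; rewrite cards2; case: eqP.
  - exact: leq_subr.
have card_tuples : #|tuples| = (#|V| ^ r)%N.
  by rewrite cardsE card_ffun_on card_ord.
have cW : #|{: W}| = (K ^ n)%N by rewrite card_ffun !card_ord.
rewrite -cW.
apply: (@leq_trans (#|finset.setX codes tuples| * (2 ^ n * K ^ (n %/ q)))%N);
  last by rewrite cardsX card_tuples leq_mul2r leq_mul2r card_codes !orbT.
apply: (@card_le_fibers _ _ (fun w => (code w, (f w).2))) => [w|u].
  have [zb zd tV _] := fP w; rewrite !inE /=; apply/andP; split; last first.
    by apply/ffun_onP => j; exact: tV.
  rewrite leq_subRL; last by apply: leq_trans zd; rewrite leq_addl.
  rewrite addnC; apply: leq_trans zd; rewrite leq_add2r; apply: subset_leq_card.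
  apply/fintype.subsetP => i; rewrite !inE; apply: contraNT; rewrite negb_and !negbK.
  case/orP => /eqP zi; apply/orP; [left | right]; apply/eqP/val_inj => /=;
    rewrite codeE zi ?mulr0 ?truncn0 //.
  by rewrite -natrM natrK.
have [-> | [w0]] := set_0Vmem [set w | (code w, (f w).2) == u]%SET.
  by rewrite cards0.
rewrite inE => /eqP uE.
apply: (@leq_trans (#|[set w : W | (#|[set i | w i \notin [set w0 i]%SET]%SET|
  <= n %/ q)%N]%SET|)%N); last first.
  have := @card_mostly_in n 'I_K (fun i => [set w0 i]%SET) 1 (n %/ q).
  by rewrite card_ord; apply => //; [move=> i; rewrite cards1 | exact: leq_div].
apply: subset_leq_card; apply/fintype.subsetP => w; rewrite !inE -uE => /eqP[cE tE].
rewrite leq_divRL //.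
have -> : [set i | w i \notin [set w0 i]%SET]%SET = [set i | w i != w0 i]%SET.
  by apply/setP => i; rewrite !inE.
have [zb _ _ ew] := fP w; have [zb0 _ _ ew0] := fP w0.
apply: (@hamming_from_errors R n K q D r w w0 x (f w).1 (f w0).1 (f w).2) => //.
  move=> i; have := codeE w i; rewrite cE codeE => trE.
  have /andP[a1 a2] := @truncn_itv R (2 * (f w).1 0 i) ltac:(have /andP[] := zb i; lra).
  have /andP[b1 b2] := @truncn_itv R (2 * (f w0).1 0 i) ltac:(have /andP[] := zb0 i; lra).
  rewrite -trE -natr1 in a1 a2; rewrite -natr1 in b2.
  by rewrite ler_norml; apply/andP; split; lra.
by rewrite tE.
Qed.

(** Put [K = 36 ^ q] and [h = n %/ q]. Bounding [2 * K + 1] by [3 * K] and cancelling powers of [K]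
    leaves [K ^ (d - h) <= 18 ^ n * m ^ r], while [n <= q * (d - h)] makes the left side at least
    [36 ^ n]. *)
Lemma exponential_count (n d q m r : nat) :
  (0 < q)%N -> (d <= n)%N -> (2 * n <= q * d)%N ->
  ((36 ^ q) ^ n <= 3 ^ n * (2 * 36 ^ q).+1 ^ (n - d) * m ^ r *
     (2 ^ n * (36 ^ q) ^ (n %/ q)))%N ->
  (2 ^ n <= m ^ r)%N.
Proof.
move=> q0 dn nd; set K := (36 ^ q)%N; set h := (n %/ q)%N => le.
have K0 : (0 < K)%N by rewrite expn_gt0.
have hq : (h * q <= n)%N by exact: leq_divM.
have hd : (h <= d)%N by rewrite -(leq_pmul2r q0); lia.
have hdn : (n <= q * (d - h))%N by rewrite mulnBr; lia.
have Kpow : (36 ^ n <= K ^ (d - h))%N by rewrite -expnM leq_pexp2l.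
have base : ((2 * K).+1 ^ (n - d) <= 3 ^ n * K ^ (n - d))%N.
  apply: (@leq_trans ((3 * K) ^ (n - d))%N).
    by case: (n - d)%N => // e; rewrite leq_exp2r // (mulSn 2) -add1n leq_add2r.
  by rewrite expnMn leq_mul2r leq_pexp2l ?orbT // leq_subr.
have : (K ^ (n - (d - h)) * 36 ^ n <= K ^ (n - (d - h)) * (18 ^ n * m ^ r))%N.
  apply: (@leq_trans (K ^ n)%N).
    have dhn : (d - h <= n)%N by lia.
    by rewrite -[X in (_ <= K ^ X)%N](subnK dhn) expnD leq_mul2l Kpow orbT.
  apply: leq_trans le _.
  have -> : (n - (d - h) = (n - d) + h)%N by lia.
  have -> : (18 ^ n = 3 ^ n * 3 ^ n * 2 ^ n)%N by rewrite -!expnMn.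
  rewrite expnD.
  have -> : (K ^ (n - d) * K ^ h * (3 ^ n * 3 ^ n * 2 ^ n * m ^ r) =
    3 ^ n * (3 ^ n * K ^ (n - d)) * m ^ r * (2 ^ n * K ^ h))%N by ring.
  by rewrite !leq_mul.
rewrite leq_pmul2l ?expn_gt0 ?K0 //.
have -> : (36 = 18 * 2)%N by [].
by rewrite expnMn leq_pmul2l ?expn_gt0.
Qed.

Theorem theorem1p2 (R : realType) (lambda : nat) (beta : R)
    (hlambda : (3 <= lambda)%N) (hbeta : 0 < beta <= 1) :
  exists theta : R, 0 < theta /\
    forall (n : nat) (S : {set 'rV[bool]_n}) (x : 'rV[R]_n) (F : set 'rV[R]_n),
      cube_ideal R S ->
      connectivity R S = (lambda%:R)%:E ->
      (forall i, x 0 i = lambda%:R^-1 \/ x 0 i = 1 - lambda%:R^-1) ->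
      is_minimal_face_containing (conv_hull R S) x F ->
      beta * n%:R <= (affine_dim F)%:R ->
      expR (theta * n%:R) <=
        (#|[set s in S | cube_point R s \in F]%SET|)%:R.
Proof.
have /andP[b0 _] := hbeta.
(* With [q * beta >= 2], the dimension bound yields [2 * n <= q * dim F], as the final count
   requires. *)
pose q := Num.bound (2 / beta).
have qb : 2 <= q%:R * beta.
  by rewrite -ler_pdivrMr // ltW // archi_boundP // divr_ge0 // ltW.
have q0 : (0 < q)%N.
  by rewrite lt0n; apply/eqP => qE; move: qb; rewrite qE mul0r; lra.
pose D := (lambda * lambda.+1)%N; pose K := (36 ^ q)%N.
pose r := (16 * q * (K * D) ^ 2)%N.
have KD0 : (0 < K * D)%N.
  by rewrite !muln_gt0 expn_gt0 /= andbT (leq_trans _ hlambda).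
have r0 : (0 < r)%N by rewrite muln_gt0 expn_gt0 KD0 muln_gt0 q0.
have r0R : 0 < r%:R :> R by rewrite ltr0n.
(* The count gives [2 ^ n <= #|V| ^ r]; this [theta] is what an [r]-th root turns it into. *)
exists (ln 2 / r%:R); split; first by rewrite divr_gt0 // ln_gt0 // ltr1n.
move=> n S x F S_ideal S_conn x_val minF dimF.
set V := finset _.
have [faceF Fx _] := minF.
have [B [fB BF]] := direction_matrix Fx.
have flatB i : flat x S (row i B).
  by have [p [p' [Fp Fp' ->]]] := BF i; exact: minimal_face_flat minF Fp Fp'.
have approx (l : 'rV[R]_n) : (l <= B)%MS -> (forall i, `|l 0 i| <= D%:R^-1) ->
    exists t : {ffun 'I_r -> 'rV[bool]_n}, (forall j, t j \in V) /\
    \sum_i (\sum_j (cube_point R (t j) 0 i - (x + l) 0 i)) ^+ 2 <= r%:R * n%:R.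
  move=> lB lD.
  have Fxl := face_perturb hlambda x_val S_ideal S_conn faceF Fx lD
    (flat_rowspace flatB lB).
  apply: empirical_approx => [i|u]; last exact: face_supporting_point faceF Fxl.
  by case: faceF Fxl => c [d [_ ->]] [hxl _]; exact: conv_hull_box hxl.
have dn : (affine_dim F <= n)%N by rewrite -(eqP fB) rank_leq_col.
have nd : (2 * n <= q * affine_dim F)%N.
  rewrite -(ler_nat R) !natrM.
  apply: (@le_trans _ _ (q%:R * (beta * n%:R))); last by rewrite ler_wpM2l.
  by rewrite mulrA ler_wpM2r.
have := exponential_count q0 dn nd (encode_grid fB KD0 q0 erefl approx).
rewrite -(ler_nat R) !natrX => le2.
rewrite -(@ler_pXn2r _ r) ?nnegrE ?expR_ge0 //.
by rewrite -expRM_natr mulrAC divfK ?gt_eqF // expRM_natr lnK // posrE.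
Qed.
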